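(* Let $P$ be a set of $n$ points in general position in the plane. Then there are two points $p_1,p_2\in\mathbb{R}^2$ such that (1) every closed halfplane containing at least one of $p_1,p_2$ contains at least $\frac{n}{5}$ points of $P$, and (2) every closed halfplane containing both $p_1$ and $p_2$ contains at least $\frac{2n}{5}$ points of $P$.
   Context: General position means no three points of $P$ are collinear. *)

(* Defs.v *)
From mathcomp Require Import all_boot all_order all_algebra.
From mathcomp Require Import reals.
Set Implicit Arguments. Unset Strict Implicit. Unset Printing Implicit Defensive.
Import Order.TTheory GRing.Theory Num.Theory.
Local Open Scope ring_scope.

Section Defs.
Variable R : realType.
Definition point := (R * R)%type.

Definition collinear (p q r : point) : bool :=
  (q.1 - p.1) * (r.2 - p.2) == (q.2 - p.2) * (r.1 - p.1).

Definition general_position (P : seq point) : Prop :=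
  uniq P /\
  forall p q r, p \in P -> q \in P -> r \in P ->
    p != q -> q != r -> p != r -> ~~ collinear p q r.

Definition in_halfplane (a b c : R) (x : point) : bool :=
  a * x.1 + b * x.2 <= c.

Definition is_halfplane (a b : R) : Prop := (a, b) != (0, 0).

Definition hp_count (P : seq point) (a b c : R) : nat :=
  count (in_halfplane a b c) P.
End Defs.

(* Main.v *)
(** Let [C] be the intersection of the closed halfplanes containing more than
    [4n/5] points of [P]; condition (1) says that both points lie in [C].
    Condition (2) says that every closed halfplane containing more than [3n/5]
    points contains one of them. Counting and Helly's theorem show that any two
    halfplanes of the latter kind meet inside [C]. Take for [p1] an extreme
    point of [C] (one of maximal norm). Inside [C], the halfplanes missing
    [p1] cut off caps that behave like pairwise intersecting intervals of the
    boundary of [C] with [p1] removed: Radon's theorem, applied to [p1] and the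
    three pairwise intersection points, shows that any three of them meet. By
    Helly's theorem and compactness they all share a point [p2] of [C]. *)

From mathcomp Require Import all_boot all_order all_algebra.
From mathcomp Require Import finmap.
From mathcomp Require Import all_classical reals topology normedtype derive.
From mathcomp Require Import zify ring lra.
Require Import Defs.
Import Order.TTheory GRing.Theory Num.Theory.
Import numFieldNormedType.Exports.
Local Open Scope ring_scope.
Local Open Scope classical_set_scope.

(** * Counting preliminaries *)

Lemma count_common3 (T : eqType) (s : seq T) (a b c : pred T) :
  (2 * size s < count a s + count b s + count c s)%N ->
  exists x, [/\ x \in s, a x, b x & c x].
Proof.
elim: s => [//|x s IH] /= lt_s.
have [/and3P[ax bx cx]|abcx] := boolP [&& a x, b x & c x].
  by exists x; rewrite mem_head.
(* An entry violating one of the predicates adds at most 2 to the sum of counts, so dropping it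
   keeps the strict bound. *)
have /IH[y [ys ay by_ cy]] : (2 * size s < count a s + count b s + count c s)%N.
  by move: abcx lt_s; case: (a x) (b x) (c x) => [] [] [] //=; lia.
by exists y; rewrite inE ys orbT.
Qed.

(** Lets an open halfplane be shrunk to a closed one that contains the same points of a finite
    set. *)
Lemma exists_gap_above (R : realType) (s : seq R) (c : R) :
  exists2 c', c < c' & forall v, v \in s -> c < v -> c' <= v.
Proof.
elim: s => [|x s [c' cc' sP]]; first by exists (c + 1) => //; lra.
have [xc|cx] := leP x c.
  exists c' => // v; rewrite inE => /predU1P[->|]; last exact: sP.
  by rewrite ltNge xc.
exists (Num.min x c'); first by rewrite lt_min cx cc'.
move=> v; rewrite inE => /predU1P[-> _|vs cv]; first by rewrite ge_min lexx.
by rewrite ge_min (sP v vs cv) orbT.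
Qed.

(** * Convexity, Radon points and Helly's theorem in the plane *)

Section PlaneConvexity.
Context {R : realType}.
Notation plane := (R * R)%type.
Implicit Types (x y z p q : plane) (A B C D : set plane).

Definition plane_convex A := forall x y (t : R), A x -> A y -> 0 <= t <= 1 ->
  A (t * x.1 + (1 - t) * y.1, t * x.2 + (1 - t) * y.2).

Lemma plane_convexI A B :
  plane_convex A -> plane_convex B -> plane_convex (A `&` B).
Proof.
by move=> cA cB x y t [Ax Bx] [Ay By] t01; split; [exact: cA|exact: cB].
Qed.

Lemma plane_convex_bigcap (I : Type) (D : set I) (F : I -> set plane) :
  (forall i, D i -> plane_convex (F i)) -> plane_convex (\bigcap_(i in D) F i).
Proof.
by move=> cF x y t Fx Fy t01 i Di; apply: cF => //; [exact: Fx|exact: Fy].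
Qed.

(** Only points of positive weight must lie in [A]; Radon's argument needs this, since it drops
    indices by giving them weight 0. Weights stay unnormalised so that the induction can peel off
    one of them. *)
Lemma plane_convex_mean A n (w : 'I_n -> R) (x : 'I_n -> plane) :
  plane_convex A -> (forall i, 0 <= w i) -> (forall i, 0 < w i -> A (x i)) ->
  0 < \sum_i w i ->
  A ((\sum_i w i * (x i).1) / \sum_i w i, (\sum_i w i * (x i).2) / \sum_i w i).
Proof.
move=> cA; elim: n w x => [|n IH] w x w0 wA; first by rewrite big_ord0 ltxx.
rewrite !big_ord_recl.
set W := \sum_(i < n) w _; set X := \sum_(i < n) _ * _.1.
set Y := \sum_(i < n) _ * _.2 => W_gt0.
have := w0 ord0; rewrite le0r => /predU1P[w00|w0_gt0].
  move: W_gt0; rewrite w00 !mul0r !add0r => W_gt0.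
  by apply: IH => // i; exact: wA.
have W_ge0 : 0 <= W by apply: sumr_ge0.
move: (W_ge0); rewrite le0r => /predU1P[W0|Wp].
  have wi0 i : w (lift ord0 i) = 0.
    move: W0 => /eqP; rewrite psumr_eq0 => [/allP/(_ i)|//].
    by rewrite mem_index_enum => /(_ isT)/eqP.
  have -> : X = 0 by apply: big1 => i _; rewrite wi0 mul0r.
  have -> : Y = 0 by apply: big1 => i _; rewrite wi0 mul0r.
  rewrite W0 !addr0 ![w ord0 * _]mulrC !mulfK ?gt_eqF//.
  by rewrite -surjective_pairing; exact: wA.
(* The full mean is a convex combination of the first point and the mean of the others. *)
have := cA (x ord0) (X / W, Y / W) (w ord0 / (w ord0 + W)) (wA _ w0_gt0).
have -> : 0 <= w ord0 / (w ord0 + W) <= 1.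
  by apply/andP; split; rewrite ?divr_ge0 ?ler_pdivrMr ?mul1r ?lerDl// ltW.
have Wn0 : W != 0 by rewrite gt_eqF.
have sn0 : w ord0 + W != 0 by rewrite gt_eqF.
rewrite /= => /(_ (IH _ _ (fun i => w0 _) (fun i => wA _) Wp) isT).
by congr (A (_, _)); field; rewrite Wn0 sn0.
Qed.

(** The four rows [(1, x, y)] lie in a space of dimension 3, hence are linearly dependent; the
    column of ones makes the weights sum to 0. *)
Lemma affine_dependence4 (x : 'I_4 -> plane) :
  exists w : 'I_4 -> R, [/\ exists i, w i != 0, \sum_i w i = 0,
    \sum_i w i * (x i).1 = 0 & \sum_i w i * (x i).2 = 0].
Proof.
pose M : 'M[R]_(4, 3) := \matrix_(i, j) [:: 1; (x i).1; (x i).2]`_j.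
have : kermx M != 0.
  by rewrite -mxrank_eq0 mxrank_ker subn_eq0 -ltnNge ltnS rank_leq_col.
case/rowV0Pn => v /sub_kermxP vM v0; exists (v 0); split.
- by case/rV0Pn: v0 => i vi; exists i.
- have /matrixP/(_ 0 (inord 0)) := vM; rewrite !mxE => vMi.
  rewrite -[RHS]vMi.
  by apply: eq_bigr => i _; rewrite !mxE inordK// mulr1.
- have /matrixP/(_ 0 (inord 1)) := vM; rewrite !mxE => vMi.
  rewrite -[RHS]vMi.
  by apply: eq_bigr => i _; rewrite !mxE inordK.
- have /matrixP/(_ 0 (inord 2)) := vM; rewrite !mxE => vMi.
  rewrite -[RHS]vMi.
  by apply: eq_bigr => i _; rewrite !mxE inordK.
Qed.

(** The witness is the Radon point: the positive part [u] and the negative part [v] of an affine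
    dependence have the same total and the same weighted mean. *)
Lemma helly4_ord (F : 'I_4 -> set plane) (x : 'I_4 -> plane) :
  (forall i, plane_convex (F i)) -> (forall i j, i != j -> F j (x i)) ->
  exists q, forall j, F j q.
Proof.
move=> cF xF; have [w [[k wk] w0 w1 w2]] := affine_dependence4 x.
pose u i := Num.max (w i) 0; pose v i := Num.max (- w i) 0.
have uv i : u i = v i + w i.
  by rewrite /u /v; case: (leP (w i) 0) => ?; case: (leP (- w i) 0) => ?; lra.
have u0 i : 0 <= u i by rewrite le_max lexx orbT.
have v0 i : 0 <= v i by rewrite le_max lexx orbT.
have S0 : \sum_i u i = \sum_i v i.
  by under eq_bigr do rewrite uv; rewrite big_split/= w0 addr0.
have S1 : \sum_i u i * (x i).1 = \sum_i v i * (x i).1.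
  by under eq_bigr do rewrite uv mulrDl; rewrite big_split/= w1 addr0.
have S2 : \sum_i u i * (x i).2 = \sum_i v i * (x i).2.
  by under eq_bigr do rewrite uv mulrDl; rewrite big_split/= w2 addr0.
(* If [u] had total 0, so would [v], and then [w k] would vanish. *)
have Su : 0 < \sum_i u i.
  rewrite lt_neqAle sumr_ge0// andbT eq_sym; apply: contra wk => Su0.
  have := Su0; rewrite S0 psumr_eq0// => /allP/(_ k).
  rewrite mem_index_enum => /(_ isT)/eqP vk.
  have := Su0; rewrite psumr_eq0// => /allP/(_ k).
  rewrite mem_index_enum => /(_ isT)/eqP uk.
  by have := uv k; rewrite uk vk add0r => <-.
exists ((\sum_i u i * (x i).1) / \sum_i u i,
        (\sum_i u i * (x i).2) / \sum_i u i).
(* The sign of [w j] tells which of the two parts omits the index [j]; all points used by that part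
   lie in [F j]. *)
move=> j; have [wj|wj] := leP (w j) 0.
  apply: plane_convex_mean => // i; rewrite lt_max ltxx orbF => wi.
  by apply: xF; apply: contraTneq wi => ->; rewrite -leNgt.
rewrite S0 S1 S2; apply: plane_convex_mean => //; last by rewrite -S0.
move=> i; rewrite lt_max ltxx orbF oppr_gt0 => wi.
by apply: xF; apply: contraTneq wi => ->; rewrite -leNgt ltW.
Qed.

Lemma helly4 A B C D :
  plane_convex A -> plane_convex B -> plane_convex C -> plane_convex D ->
  A `&` B `&` C !=set0 -> A `&` B `&` D !=set0 ->
  A `&` C `&` D !=set0 -> B `&` C `&` D !=set0 ->
  A `&` B `&` C `&` D !=set0.
Proof.
move=> cA cB cC cD [d [[Ad Bd] Cd]] [c [[Ac Bc] Dc]] [b [[Ab Cb] Db]]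
  [a [[Ba Ca] Da]].
have [|i j ij|q qF] := @helly4_ord (fun i => nth setT [:: A; B; C; D] i)
  (fun i => nth a [:: a; b; c; d] i).
- by case=> -[|[|[|[|]]]].
- by case: i j ij => -[|[|[|[|//]]]] ? [] [|[|[|[|//]]]].
- exists q; split; [split; [split|]|].
  + exact: (qF (@Ordinal 4 0 isT)).
  + exact: (qF (@Ordinal 4 1 isT)).
  + exact: (qF (@Ordinal 4 2 isT)).
  + exact: (qF (@Ordinal 4 3 isT)).
Qed.

(** Induction that merges two sets into their intersection; [helly4] provides the triples involving
    the merged set. The three sets in the hypothesis may coincide, so it also covers pairs and
    single sets. *)
Lemma helly_seq (s : seq (set plane)) :
  s != [::] -> (forall A, A \in s -> plane_convex A) ->
  (forall A B C, A \in s -> B \in s -> C \in s -> A `&` B `&` C !=set0) ->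
  exists q, forall A, A \in s -> A q.
Proof.
have [n] := ubnP (size s); elim: n s => [//|n IH] [//|A [|B s]] /= sn _ cs s3.
  have [|||q [_ Aq]] := s3 A A A; rewrite ?mem_head//.
  by exists q => C; rewrite inE => /eqP->.
have mA : A \in [:: A, B & s] by rewrite mem_head.
have mB : B \in [:: A, B & s] by rewrite !inE eqxx orbT.
have ms C : C \in s -> C \in [:: A, B & s] by rewrite !inE => ->; rewrite !orbT.
have ABCD C D : C \in s -> D \in s -> A `&` B `&` C `&` D !=set0.
  move=> /ms mC /ms mD; apply: helly4; try exact: cs; exact: s3.
have cAB : plane_convex (A `&` B) by apply: plane_convexI; exact: cs.
have [||C|C D E|q qs] := IH (A `&` B :: s) => //.
- by rewrite inE => /predU1P[->//|/ms/cs].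
- rewrite !inE => /predU1P[->|Cs] /predU1P[->|Ds] /predU1P[->|Es].
  + by rewrite !setIid; have [q [[? ?] _]] := s3 A B A mA mB mA; exists q.
  + by rewrite setIid; apply: s3 => //; exact: ms.
  + have [q [[? ?] ?]] := s3 A B D mA mB (ms _ Ds); exists q.
    by split; [split|].
  + by apply: ABCD.
  + have [q [[? ?] ?]] := s3 A B C mA mB (ms _ Cs); exists q.
    by split; [split|].
  + by rewrite [C `&` _]setIC; apply: ABCD.
  + by rewrite setIC setIA; apply: ABCD.
  + by apply: s3; exact: ms.
have [Aq Bq] : (A `&` B) q by apply: qs; rewrite mem_head.
by exists q => C; rewrite !inE => /predU1P[->//|/predU1P[->//|Cs]];
  apply: qs; rewrite inE Cs orbT.
Qed.

(** [helly_seq] yields the finite intersection property, and a cluster point in [K] lies in every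
    closed [F i]. Prepending [i0] keeps the finite families nonempty. *)
Lemma helly_compact (I : choiceType) (D : set I) (F : I -> set plane)
    (K : set plane) :
  compact K -> D !=set0 ->
  (forall i, D i -> closed (F i)) -> (forall i, D i -> F i `<=` K) ->
  (forall i, D i -> plane_convex (F i)) ->
  (forall i j k, D i -> D j -> D k -> F i `&` F j `&` F k !=set0) ->
  \bigcap_(i in D) F i !=set0.
Proof.
move=> cK [i0 Di0] clF FK cF F3.
have fip : finI D F.
  move=> D' D'D.
  have inD i : i \in D' -> D i by move=> /D'D; rewrite inE.
  have inS A : A \in [seq F i | i <- i0 :: D'] -> exists2 i, D i & A = F i.
    case/mapP => i; rewrite inE => /predU1P[->|/inD Di] ->; first by exists i0.
    by exists i.
  have [//|A|A B C|q qF] := @helly_seq [seq F i | i <- i0 :: D'].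
  - by case/inS => i Di ->; exact: cF.
  - by move=> /inS[i Di ->] /inS[j Dj ->] /inS[k Dk ->]; exact: F3.
  - by exists q => i iD'; apply: qF; apply: map_f; rewrite inE iD' orbT.
have [|q [_ qF]] := cK _ (finI_filter fip).
  by exists (F i0); [exact: finI_from1|exact: FK].
exists q => i Di; apply: clF => // B.
by apply: qF; exists (F i); [exact: finI_from1|].
Qed.

End PlaneConvexity.

(** * Halfplanes missing an extreme point *)

Section Halfplanes.
Context {R : realType}.
Notation plane := (R * R)%type.
Implicit Types (h f g : R * R * R) (p q x y z : plane).

(** A triple [((a, b), c)] encodes the affine form [a x + b y - c]. Degenerate triples are allowed;
    [(0, 0, 0)] gives the whole plane. *)
Definition gap h x : R := h.1.1 * x.1 + h.1.2 * x.2 - h.2.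

Definition upper h : set plane := [set x | 0 <= gap h x].

Lemma upper_convex h : plane_convex (upper h).
Proof.
move=> x y t; rewrite /upper /= => hx hy /andP[t0 t1].
have -> : gap h (t * x.1 + (1 - t) * y.1, t * x.2 + (1 - t) * y.2) =
  t * gap h x + (1 - t) * gap h y by rewrite /gap/=; ring.
by apply: addr_ge0; apply: mulr_ge0 => //; rewrite subr_ge0.
Qed.

Lemma upper_closed h : closed (upper h).
Proof.
have cg : continuous (gap h).
  move=> x; apply: cvgB; last exact: cvg_cst.
  by apply: cvgD; apply: cvgMr; [exact: cvg_fst|exact: cvg_snd].
have -> : upper h = gap h @^-1` [set y | 0 <= y] by [].
by apply: preimage_closed => [? _|]; [exact: cg|exact: closed_ge].
Qed.

Definition box (M : R) : set plane :=
  [set x | - M <= x.1 <= M /\ - M <= x.2 <= M].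

Lemma box_compact M : compact (box M).
Proof.
rewrite (_ : box M = `[- M, M] `*` `[- M, M]).
  by apply: compact_setX; exact: segment_compact.
by apply/seteqP; split=> x; rewrite /box /= !in_itv.
Qed.

Lemma box_convex M : plane_convex (box M).
Proof.
move=> x y t [x1 x2] [y1 y2] /andP[t0 t1]; move: x1 x2 y1 y2.
by rewrite /box/=; split; nra.
Qed.

Lemma exists_box (P : seq plane) : exists M, forall p, p \in P -> box M p.
Proof.
elim: P => [|p P [M PM]]; first by exists 0.
exists (Num.max M (Num.max `|p.1| `|p.2|)) => q.
rewrite inE => /predU1P[->|/PM].
  by rewrite /box /= -!ler_norml !le_max !lexx !orbT.
by rewrite /box /= -!ler_norml !le_max => -[-> ->].
Qed.

Lemma compact_max_norm_point (C : set plane) : compact C -> C !=set0 ->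
  exists2 p, C p & forall x, C x -> x.1 ^+ 2 + x.2 ^+ 2 <= p.1 ^+ 2 + p.2 ^+ 2.
Proof.
move=> cC C0.
have cn : continuous (fun x : plane => x.1 ^+ 2 + x.2 ^+ 2 : R).
  move=> x; rewrite (_ : (fun x : plane => _) = fun x => x.1 * x.1 + x.2 * x.2).
    by apply: cvgD; apply: cvgM; (exact: cvg_fst || exact: cvg_snd).
  by apply/funext => y; rewrite !expr2.
have [p Cp pmax] := compact_EVT_max C0 cC (continuous_subspaceT cn).
exists p; first by rewrite inE in Cp.
by move=> x Cx; apply: pmax; rewrite inE.
Qed.

(* Taking the inner product of [(a + b + c) p = a x + b y + c z] with [p] gives
   [a (|x - p|^2 + |p|^2 - |x|^2) + ... = 0], a sum of nonnegative terms. *)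
Lemma max_norm_extreme p x y z (a b c : R) :
  (forall q, q \in [:: x; y; z] ->
    q != p /\ q.1 ^+ 2 + q.2 ^+ 2 <= p.1 ^+ 2 + p.2 ^+ 2) ->
  0 <= a -> 0 <= b -> 0 <= c -> 0 < a + b + c ->
  (a + b + c) * p.1 = a * x.1 + b * y.1 + c * z.1 ->
  (a + b + c) * p.2 = a * x.2 + b * y.2 + c * z.2 -> False.
Proof.
move=> pmax a0 b0 c0 s0 e1 e2.
pose n q := (q.1 - p.1) ^+ 2 + (q.2 - p.2) ^+ 2 : R.
pose m q := p.1 ^+ 2 + p.2 ^+ 2 - (q.1 ^+ 2 + q.2 ^+ 2) : R.
have npos q : q \in [:: x; y; z] -> 0 < n q /\ 0 <= m q.
  move=> /pmax[qp qle]; split; last by rewrite subr_ge0.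
  rewrite lt_neqAle addr_ge0 ?sqr_ge0// andbT eq_sym paddr_eq0 ?sqr_ge0//.
  rewrite !sqrf_eq0 !subr_eq0; apply: contra qp => /andP[/eqP q1 /eqP q2].
  by rewrite [q]surjective_pairing [p]surjective_pairing q1 q2.
have [nx mx] : 0 < n x /\ 0 <= m x by apply: npos; rewrite !inE eqxx.
have [ny my] : 0 < n y /\ 0 <= m y by apply: npos; rewrite !inE eqxx ?orbT.
have [nz mz] : 0 < n z /\ 0 <= m z by apply: npos; rewrite !inE eqxx ?orbT.
have E : a * (n x + m x) + b * (n y + m y) + c * (n z + m z) = 0.
  transitivity (2 * (p.1 * ((a + b + c) * p.1 - (a * x.1 + b * y.1 + c * z.1)) +
     p.2 * ((a + b + c) * p.2 - (a * x.2 + b * y.2 + c * z.2)))).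
    by rewrite /n /m; ring.
  by rewrite e1 e2 !subrr !mulr0 addr0 mulr0.
have ax : 0 <= a * (n x + m x) by apply: mulr_ge0 => //; lra.
have by_ : 0 <= b * (n y + m y) by apply: mulr_ge0 => //; lra.
have cz : 0 <= c * (n z + m z) by apply: mulr_ge0 => //; lra.
have ea : a * (n x + m x) = 0 by lra.
have eb : b * (n y + m y) = 0 by lra.
have ec : c * (n z + m z) = 0 by lra.
have a00 : a = 0 by move/eqP: ea; rewrite mulf_eq0 => /orP[/eqP//|/eqP]; lra.
have b00 : b = 0 by move/eqP: eb; rewrite mulf_eq0 => /orP[/eqP//|/eqP]; lra.
have c00 : c = 0 by move/eqP: ec; rewrite mulf_eq0 => /orP[/eqP//|/eqP]; lra.
lra.
Qed.

Definition dependent4 p x y z (d a b c : R) :=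
  [/\ d + a + b + c = 0,
      d * p.1 + a * x.1 + b * y.1 + c * z.1 = 0 &
      d * p.2 + a * x.2 + b * y.2 + c * z.2 = 0].

Lemma gap_dependent4 h p x y z (d a b c : R) : dependent4 p x y z d a b c ->
  d * gap h p + a * gap h x + b * gap h y + c * gap h z = 0.
Proof.
move=> [e0 e1 e2].
transitivity (h.1.1 * (d * p.1 + a * x.1 + b * y.1 + c * z.1) +
  h.1.2 * (d * p.2 + a * x.2 + b * y.2 + c * z.2) - h.2 * (d + a + b + c)).
  by rewrite /gap; ring.
by rewrite e0 e1 e2 !mulr0 !addr0 subr0.
Qed.

(** Negating all weights if necessary makes the weight of [p] nonnegative, so that only the signs of
    the other three matter. *)
Lemma exists_dependent4 p x y z : exists d a b c : R,
  [/\ dependent4 p x y z d a b c, 0 <= d & (d, a, b, c) != (0, 0, 0, 0)].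
Proof.
have [w [[i wi] w0 w1 w2]] := affine_dependence4 (tnth [tuple p; x; y; z]).
move: w0 w1 w2; rewrite !big_ord_recl !big_ord0 /= !addr0 !(tnth_nth p) /=.
set d := w ord0; set a := w (lift ord0 _); set b := w (lift ord0 (lift ord0 _)).
set c := w _ => w0 w1 w2.
have n0 : (d, a, b, c) != (0, 0, 0, 0).
  apply: contra wi => /eqP[d0 a0 b0 c0]; apply/eqP.
  by case: i => -[|[|[|[|//]]]] i4;
    [rewrite -d0|rewrite -a0|rewrite -b0|rewrite -c0];
    congr w; apply: val_inj.
have [d0|d0] := leP 0 d.
  by exists d, a, b, c; split => //; split; rewrite -!addrA.
exists (- d), (- a), (- b), (- c); split; first by split; lra.
  by rewrite oppr_ge0 ltW.
by apply: contra n0 => /eqP[/eqP + /eqP + /eqP + /eqP]; rewrite !oppr_eq0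
  => /eqP-> /eqP-> /eqP-> /eqP->.
Qed.

(* The segments [p x] and [y z] cross, which [h] would separate. *)
Lemma triple_point_opposite h p x y z d a b c :
  gap h p < 0 -> dependent4 p x y z d a b c ->
  0 <= d -> 0 < a -> b <= 0 -> c <= 0 ->
  0 <= gap h y -> 0 <= gap h z -> 0 <= gap h x.
Proof.
move=> hp /(gap_dependent4 h) dep d0 a0 b0 c0 hy hz.
rewrite leNgt; apply/negP => hx.
have : d * gap h p <= 0 by rewrite mulr_ge0_le0 // ltW.
have : a * gap h x < 0 by rewrite pmulr_rlt0.
have : b * gap h y <= 0 by rewrite mulr_le0_ge0.
have : c * gap h z <= 0 by rewrite mulr_le0_ge0.
lra.
Qed.

(* [z] lies in the triangle [p x y]: project it from [p] onto the side [x y]. *)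
Lemma triple_point_inside f g h p (C : set plane) x y z d a b c :
  gap f p < 0 -> gap h p < 0 -> plane_convex C -> C x -> C y ->
  dependent4 p x y z d a b c -> 0 <= d -> 0 < a -> 0 < b ->
  0 <= gap g x -> 0 <= gap g y -> 0 <= gap f z -> 0 <= gap h z ->
  exists2 q, C q & [/\ 0 <= gap f q, 0 <= gap g q & 0 <= gap h q].
Proof.
move=> fp hp cC Cx Cy dep d0 a0 b0 gx gy fz hz.
have ab0 : 0 < a + b by rewrite addr_gt0.
have abn : a + b != 0 by rewrite gt_eqF.
have t01 : 0 <= a / (a + b) <= 1.
  by apply/andP; split; rewrite ?divr_ge0 ?ler_pdivrMr ?mul1r ?lerDl// ltW.
pose q : plane := (a / (a + b) * x.1 + (1 - a / (a + b)) * y.1,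
                   a / (a + b) * x.2 + (1 - a / (a + b)) * y.2).
have gapq k : (a + b) * gap k q = a * gap k x + b * gap k y.
  by rewrite /gap /q/=; field.
(* By the dependence, [(a + b) * gap k q] equals [- d * gap k p - c * gap k z], and [c] is negative
   because the weights sum to 0. *)
have pos k : gap k p < 0 -> 0 <= gap k z -> 0 <= gap k q.
  move=> kp kz; rewrite -(pmulr_rge0 _ ab0) gapq.
  have := gap_dependent4 k _ _ _ _ _ _ _ _ dep.
  have : d * gap k p <= 0 by rewrite mulr_ge0_le0 // ltW.
  have : c * gap k z <= 0.
    by rewrite mulr_le0_ge0 //; case: dep => e _ _; lra.
  lra.
exists q; first exact: cC.
split; [exact: pos| |exact: pos].
by rewrite -(pmulr_rge0 _ ab0) gapq addr_ge0// mulr_ge0// ltW.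
Qed.

(** Here [x], [y], [z] are the pairwise meeting points of [f g], [g h], [f h]. The sign pattern of a
    Radon dependence of [p, x, y, z] shows their relative position, and each position yields a
    common point or a contradiction. *)
Lemma triple_point f g h p (C : set plane) x y z :
  gap f p < 0 -> gap g p < 0 -> gap h p < 0 -> plane_convex C ->
  (forall q, C q -> q.1 ^+ 2 + q.2 ^+ 2 <= p.1 ^+ 2 + p.2 ^+ 2) ->
  C x -> C y -> C z ->
  0 <= gap f x -> 0 <= gap g x -> 0 <= gap g y -> 0 <= gap h y ->
  0 <= gap f z -> 0 <= gap h z ->
  exists2 q, C q & [/\ 0 <= gap f q, 0 <= gap g q & 0 <= gap h q].
Proof.
move=> fp gp hp cC pmax Cx Cy Cz fx gx gy hy fz hz.
have [d [a [b [c [dep d0 n0]]]]] := exists_dependent4 p x y z.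
have [e0 e1 e2] := dep.
have ne k q : gap k p < 0 -> 0 <= gap k q -> q != p.
  by move=> kp kq; apply: contraTneq kq => ->; rewrite -ltNge.
have [a0|a0] := leP a 0; have [b0|b0] := leP b 0; have [c0|c0] := leP c 0.
(* No positive weight: [p] would be a convex combination of [x], [y], [z], which maximality of its
   norm forbids. *)
- have d_gt0 : 0 < d.
    rewrite lt_neqAle d0 andbT; apply: contra n0 => /eqP d00.
    by rewrite !xpair_eqE; do !(apply/andP; split); apply/eqP; lra.
  have ed : - a - b - c = d by lra.
  have [] := @max_norm_extreme p x y z (- a) (- b) (- c);
    rewrite ?oppr_ge0 ?ed//.
  + move=> q; rewrite !inE => /or3P[] /eqP ->; split; try exact: pmax.
    * exact: ne fp fx.
    * exact: ne gp gy.
    * exact: ne fp fz.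
  + by rewrite !mulNr; apply/eqP; rewrite -subr_eq0 -e1; apply/eqP; ring.
  + by rewrite !mulNr; apply/eqP; rewrite -subr_eq0 -e2; apply/eqP; ring.
(* One positive weight: the point bearing it already lies in the third halfplane. *)
- exists z => //; split=> //.
  apply: (triple_point_opposite g p z x y d c a b) => //; split; lra.
- exists y => //; split=> //.
  apply: (triple_point_opposite f p y x z d b a c) => //; split; lra.
(* Two positive weights: the remaining point lies in the triangle spanned by [p] and the two
   others. *)
- have [|q Cq [? ? ?]] := triple_point_inside f h g p C y z x d b c a
    fp gp cC Cy Cz _ d0 b0 c0 hy hz fx gx; first by split; lra.
  by exists q.
- exists x => //; split=> //.
  exact: (triple_point_opposite h p x y z d a b c).
- have [|q Cq [? ? ?]] := triple_point_inside g f h p C x z y d a c b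
    gp hp cC Cx Cz _ d0 a0 c0 fx fz gy hy; first by split; lra.
  by exists q.
- exact: (triple_point_inside f g h p C x y z d a b c).
(* Three positive weights and [0 <= d] cannot sum to 0. *)
- lra.
Qed.
End Halfplanes.

(** * The depth region and the two piercing points *)

Section DepthRegion.
Context {R : realType}.
Notation plane := (R * R)%type.
Variable P : seq plane.

Definition mass (h : R * R * R) := count (fun x => 0 <= gap h x) P.

(** More than [k/5] of the points, stated without division. The strictness matches complements
    holding fewer than [(5 - k)/5] of them. *)
Definition large (k : nat) : set (R * R * R) :=
  [set h | (k * size P < 5 * mass h)%N].

Lemma large_whole : (0 < size P)%N -> large 4 (0, 0, 0).
Proof.
move=> P_gt0; rewrite /large /= /mass (eq_count (a2 := xpredT)) ?count_predT.
  by rewrite ltn_mul2r P_gt0.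
by move=> x; rewrite /gap /= !mul0r subr0 addr0 lexx.
Qed.

(** The three masses add up to more than twice [size P], so the pigeonhole of [count_common3]
    applies. *)
Lemma large_common3 (i j k : nat) (f g h : R * R * R) : (10 <= i + j + k)%N ->
  large i f -> large j g -> large k h ->
  exists x, [/\ x \in P, 0 <= gap f x, 0 <= gap g x & 0 <= gap h x].
Proof.
rewrite /large /= => ijk Lf Lg Lh.
have le10 : (10 * size P <= i * size P + j * size P + k * size P)%N.
  by rewrite -!mulnDl leq_mul2r ijk orbT.
have lt2 : (2 * size P < mass f + mass g + mass h)%N by lia.
exact: (count_common3 _ _ _ _ _ lt2).
Qed.

Lemma large4_3 : large 4 `<=` large 3.
Proof. by move=> h; rewrite /large/=; lia. Qed.

(** The box makes the region compact; it is later chosen to contain [P], so common points found in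
    [P] survive the restriction. *)
Definition depth_region (M : R) : set plane :=
  box M `&` \bigcap_(h in large 4) upper h.

Lemma depth_region_closed M : closed (depth_region M).
Proof.
apply: closedI; last by apply: closed_bigI => h _; exact: upper_closed.
by apply: compact_closed; [exact: norm_hausdorff|exact: box_compact].
Qed.

Lemma depth_region_convex M : plane_convex (depth_region M).
Proof.
apply: plane_convexI; first exact: box_convex.
by apply: plane_convex_bigcap => h _; exact: upper_convex.
Qed.

(** Helly for the [large 4] halfplanes together with [f] and [g]: a triple with a [large 4] member
    has thresholds adding up to at least [3 + 3 + 4 = 10]. *)
Lemma depth_region_meets (M : R) (f g : R * R * R) :
  (0 < size P)%N -> (forall p, p \in P -> box M p) -> large 3 f -> large 3 g ->
  exists2 x, depth_region M x & 0 <= gap f x /\ 0 <= gap g x.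
Proof.
move=> P_gt0 PM Lf Lg.
pose D : set (R * R * R) := [set h | large 4 h \/ (h = f \/ h = g)].
have D3 h : D h -> large 3 h by case=> [/large4_3//|[->|->]].
have common h : large 4 h ->
    exists x, [/\ x \in P, 0 <= gap f x, 0 <= gap g x & 0 <= gap h x].
  by move=> Lh; exact: (@large_common3 3 3 4).
have [||h _|h _|h _|h1 h2 h3|q qD] :=
    @helly_compact R _ D (fun h => box M `&` upper h) (box M).
- exact: box_compact.
- by exists f; right; left.
- apply: closedI; last exact: upper_closed.
  by apply: compact_closed; [exact: norm_hausdorff|exact: box_compact].
- exact: subIsetl.
- by apply: plane_convexI; [exact: box_convex|exact: upper_convex].
- suff H : D h1 -> D h2 -> D h3 -> exists x,
      [/\ x \in P, 0 <= gap h1 x, 0 <= gap h2 x & 0 <= gap h3 x].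
    move=> D1 D2 D3'; have [x [/PM xM x1 x2 x3]] := H D1 D2 D3'.
    by exists x; split; [split|].
  move=> D1 D2 D3'; have [L1 L2 L3] := And3 (D3 _ D1) (D3 _ D2) (D3 _ D3').
  case: D1 => [K1|E1]; case: D2 => [K2|E2]; case: D3' => [K3|E3];
    try by [exact: (@large_common3 4 4 3)|exact: (@large_common3 4 3 4)
           |exact: (@large_common3 3 4 4)|exact: (@large_common3 4 4 4)].
  + have [x [xP fx gx hx]] := common _ K1; exists x.
    by case: E2 E3 => [] -> [] ->.
  + have [x [xP fx gx hx]] := common _ K2; exists x.
    by case: E1 E3 => [] -> [] ->.
  + have [x [xP fx gx hx]] := common _ K3; exists x.
    by case: E1 E2 => [] -> [] ->.
  (* All three sets are among [f] and [g], so the whole plane serves as the [large 4] member. *)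
  + have [x [xP fx gx hx]] := common _ (large_whole P_gt0); exists x.
    by case: E1 E2 E3 => [] -> [] -> [] ->.
have [qM fq] : (box M `&` upper f) q by apply: qD; right; left.
have [_ gq] : (box M `&` upper g) q by apply: qD; right; right.
exists q => //; split=> // h Lh.
by have [] : (box M `&` upper h) q by apply: qD; left.
Qed.

Lemma exists_piercing_pair : (0 < size P)%N -> exists p1 p2 : plane,
  [/\ forall h, large 4 h -> 0 <= gap h p1,
      forall h, large 4 h -> 0 <= gap h p2 &
      forall h, large 3 h -> 0 <= gap h p1 \/ 0 <= gap h p2].
Proof.
move=> P_gt0; have [M PM] := exists_box P.
have cC := depth_region_convex M.
have C0 : depth_region M !=set0.
  have L := large4_3 _ (large_whole P_gt0).
  by have [x Cx _] := depth_region_meets M _ _ P_gt0 PM L L; exists x.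
have coC : compact (depth_region M).
  apply: subclosed_compact (depth_region_closed M) (box_compact M) _.
  exact: subIsetl.
have [p Cp pmax] := compact_max_norm_point _ coC C0.
have deep x : depth_region M x -> forall h, large 4 h -> 0 <= gap h x.
  by move=> [_ xG] h /xG.
(* If no [large 3] halfplane misses [p], then [p] serves as both points; otherwise [f0] makes the
   family [D] below nonempty. *)
have [[f0 [f0L f0p]]|none] := pselect (exists h, large 3 h /\ gap h p < 0);
    last first.
  exists p, p; split; [exact: deep|exact: deep|move=> h Lh; left].
  by rewrite leNgt; apply/negP => hp; apply: none; exists h.
pose D : set (R * R * R) := [set h | large 3 h /\ gap h p < 0].
have [||h _|h _|h _|f g h [Lf fp] [Lg gp] [Lh hp]|q qD] :=
    @helly_compact R _ D (fun h => depth_region M `&` upper h) (depth_region M).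
- exact: coC.
- by exists f0.
- by apply: closedI; [exact: depth_region_closed|exact: upper_closed].
- exact: subIsetl.
- by apply: plane_convexI; [exact: cC|exact: upper_convex].
- have [x Cx [fx gx]] := depth_region_meets M f g P_gt0 PM Lf Lg.
  have [y Cy [gy hy]] := depth_region_meets M g h P_gt0 PM Lg Lh.
  have [z Cz [fz hz]] := depth_region_meets M f h P_gt0 PM Lf Lh.
  have [q Cq [fq gq hq]] := triple_point f g h p _ x y z fp gp hp cC pmax
    Cx Cy Cz fx gx gy hy fz hz.
  by exists q; split; [split|].
have [Cq _] := qD f0 (conj f0L f0p).
exists p, q; split; [exact: deep|exact: deep|move=> h Lh].
have [hp|hp] := leP 0 (gap h p); first by left.
by right; have [_ hq] := qD h (conj Lh hp).
Qed.

(** The complement of a light closed halfplane is open and heavy; moving its boundary from [c] to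
    [c'] makes it closed without losing a point of [P]. *)
Lemma light_complement_large (a b c : R) (k l : nat) : (k + l = 5)%N ->
  (hp_count P a b c)%:R < l%:R * (size P)%:R / 5 :> R ->
  exists h, large k h /\
    forall x : plane, 0 <= gap h x -> ~~ in_halfplane a b c x.
Proof.
move=> kl; rewrite ltr_pdivlMr// -!natrM ltr_nat => lt_cnt.
have [c' cc' c'P] := exists_gap_above _ [seq a * x.1 + b * x.2 | x <- P] c.
exists (a, b, c'); split; last first.
  move=> x; rewrite /gap /in_halfplane /= subr_ge0 -ltNge.
  exact: lt_le_trans.
have le_mass : (count (predC (in_halfplane a b c)) P <= mass (a, b, c'))%N.
  rewrite (@eq_in_count _ _ (predI (predC (in_halfplane a b c))
    (fun x => 0 <= gap (a, b, c') x))); first by apply: sub_count => x /andP[].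
  move=> x xP /=; case: (boolP (in_halfplane a b c x)) => //=.
  rewrite -ltNge => cx.
  by rewrite /gap subr_ge0/=; apply/esym/c'P => //; apply/mapP; exists x.
have cntE := count_predC (in_halfplane a b c) P.
have klE : (k * size P + l * size P)%N = (5 * size P)%N by rewrite -mulnDl kl.
have arith (n u v w kn ln : nat) : (u * 5 < ln)%N -> (v <= w)%N ->
  (u + v)%N = n -> (kn + ln)%N = (5 * n)%N -> (kn < 5 * w)%N by lia.
exact: arith lt_cnt le_mass cntE klE.
Qed.

End DepthRegion.

Theorem theorem3 (R : realType) (P : seq (point R)) :
  general_position P ->
  exists p1 p2 : point R,
    (forall a b c : R, is_halfplane a b ->
       in_halfplane a b c p1 || in_halfplane a b c p2 ->
       (size P)%:R / 5 <= (hp_count P a b c)%:R :> R) /\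
    (forall a b c : R, is_halfplane a b ->
       in_halfplane a b c p1 && in_halfplane a b c p2 ->
       2 * (size P)%:R / 5 <= (hp_count P a b c)%:R :> R).
Proof.
move=> _; have [/size0nil ->|P_gt0] := posnP (size P).
  (* Without points both bounds are 0. *)
  by exists (0, 0), (0, 0); split=> a b c _ _; rewrite ?mulr0 mul0r.
have [p1 [p2 [deep1 deep2 pierce]]] := exists_piercing_pair P P_gt0.
(* Contrapositive: a halfplane with too few points is disjoint from a [large 4] halfplane, which
   contains both points, or from a [large 3] one, which contains at least one. *)
exists p1, p2; split=> a b c _; apply: contraTT; rewrite -ltNge.
- rewrite -[X in X / 5]mul1r => /(@light_complement_large _ P a b c 4 1 erefl).
  by case=> h [Lh hP]; rewrite negb_or !hP ?deep1 ?deep2.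
- case/(@light_complement_large _ P a b c 3 2 erefl) => h [Lh hP].
  by rewrite negb_and; case: (pierce h Lh) => /hP ->; rewrite ?orbT.
Qed.
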